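(* Let $\mathbf{x}_1,\dots,\mathbf{x}_6$ be fixed points on $\Gamma$ chosen such that the $3\times 3$ matrix $X$ with rows $\mathbf{x}_2-\mathbf{x}_1$, $\mathbf{x}_4-\mathbf{x}_3$, $\mathbf{x}_6-\mathbf{x}_5$ is invertible. Then the knowledge of $\phi(\mathbf{x}_i,t)$, $i=1,\dots,6$, for $t\in[0,T_{\mathrm{obs}}]$, where $T_{\mathrm{obs}}=T+T_0$, determines uniquely the trajectory $\{b(t);\ t\in[0,T]\}$ of the point source. That is, if $b$ and $\tilde b$ are two admissible trajectories generating the fields $\phi$ and $\tilde\phi$ respectively, and $\phi(\mathbf{x}_i,t)=\tilde\phi(\mathbf{x}_i,t)$ for all $i=1,\dots,6$ and all $t\in[0,T_{\mathrm{obs}}]$, then $b(t)=\tilde b(t)$ for all $t\in[0,T]$.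
   Context: Let $c>0$ (wave speed), $\lambda>0$ (known source intensity) and $0\le c_0<c$ be fixed. $D\subset\mathbb{R}^3$ is a bounded domain, and $\Omega\subset\mathbb{R}^3$ is a smooth bounded domain with $\overline{D}\subset\Omega$ and boundary $\Gamma=\partial\Omega$. $|\cdot|$ and $\cdot$ denote the Euclidean norm and scalar product in $\mathbb{R}^3$. Put $T_0=\sup_{\mathbf{x}\in\Gamma,\,\mathbf{y}\in D}|\mathbf{x}-\mathbf{y}|/c$, let $T>T_0$ be fixed, and $T_{\mathrm{obs}}=T+T_0$. A trajectory $b$ is admissible if $b\in C^2([0,T_{\mathrm{obs}}];\mathbb{R}^3)$, $b(t)\in D$ for all $t$, and $|b'(t)|\le c_0$ for all $t\in[0,T_{\mathrm{obs}}]$; it is extended to negative times by $b(s)=b(0)$ for $s<0$. For $\mathbf{x}\in\Gamma$ and $t\in[0,T_{\mathrm{obs}}]$, the retarded time $r=r(\mathbf{x},t)$ is the unique solution of $r=t-|\mathbf{x}-b(r)|/c$. For $r\ge 0$ set $h(\mathbf{x},r)=1-\dfrac{b'(r)\cdot(\mathbf{x}-b(r))}{c\,|\mathbf{x}-b(r)|}$. The field generated by the source is the solution $\phi$ of $\frac{1}{c^2}\phi_{tt}-\Delta\phi=\lambda\,\delta(\mathbf{x}-b(t))$ in $\mathbb{R}^3\times(0,T_{\mathrm{obs}})$ with $\phi(\cdot,0)=\phi_t(\cdot,0)=0$, which is given at $\mathbf{x}\in\Gamma$, $t\in[0,T_{\mathrm{obs}}]$ by $$\phi(\mathbf{x},t)=\frac{\lambda}{4\pi\,|\mathbf{x}-b(r)|\,h(\mathbf{x},r)}\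 \text{ if } r=r(\mathbf{x},t)>0,\qquad \phi(\mathbf{x},t)=0\ \text{ if } r(\mathbf{x},t)\le 0 .$$ For another admissible trajectory $\tilde b$, the field $\tilde\phi$ is defined in the same way from $\tilde b$, with the same $\lambda$, $c$. *)

(* Defs.v *)
From HB Require Import structures.
From mathcomp Require Import all_boot all_order all_algebra.
From mathcomp Require Import all_classical all_reals all_analysis.
Set Implicit Arguments.
Unset Strict Implicit.
Unset Printing Implicit Defensive.
Import Order.TTheory GRing.Theory Num.Theory.
Import numFieldNormedType.Exports.
Local Open Scope classical_set_scope.
Local Open Scope ring_scope.

(* The library's norm `|u| on row vectors is the sup norm, so the Euclidean
   structure is defined here. The topology of 'rV[R]_3 (hence open, closure,
   connected, limits) and boundedness are the same for both norms. *)
Definition dot (R : realType) (u v : 'rV[R]_3) : R :=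
  \sum_(k < 3) u 0 k * v 0 k.

Definition enorm (R : realType) (u : 'rV[R]_3) : R := Num.sqrt (dot u u).

Definition boundary (T : topologicalType) (A : set T) : set T :=
  closure A `\` interior A.

Definition bounded_domain (R : realType) (A : set 'rV[R]_3) : Prop :=
  [/\ A !=set0, open A, connected A & bounded_set A].

(* C^k on an open set U, through iterated directional derivatives. *)
Fixpoint Ck_on (R : realType) (k : nat) (U : set 'rV[R]_3)
    (f : 'rV[R]_3 -> R) : Prop :=
  match k with
  | 0%N => forall y, U y -> {for y, continuous f}
  | k'.+1 => (forall y, U y -> {for y, continuous f}) /\
             forall v, (forall y, U y -> derivable f y v) /\
                       Ck_on k' U (fun y => 'D_v f y)
  end.

Definition smooth_on (R : realType) (U : set 'rV[R]_3)
    (f : 'rV[R]_3 -> R) : Prop := forall k, Ck_on k U f.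

(* Near each boundary point, Omega is the negative side of a C^oo function
   without critical points; by the implicit function theorem this is the
   description of Omega as the region on one side of a C^oo graph. *)
Definition smooth_bounded_domain (R : realType) (Omega : set 'rV[R]_3) : Prop :=
  bounded_domain Omega /\
  forall x, boundary Omega x ->
    exists (U : set 'rV[R]_3) (rho : 'rV[R]_3 -> R),
      [/\ open U, U x, smooth_on U rho,
          (forall y, U y -> exists v, 'D_v rho y != 0) &
          Omega `&` U = [set y | U y /\ rho y < 0]].

(* Derivatives of f relative to I: one-sided at the endpoints of an interval,
   so that only the values of f on I matter. *)
Definition dquot (R : realType) (f : R -> 'rV[R]_3) (t s : R) : 'rV[R]_3 :=
  (s - t)^-1 *: (f s - f t).

Definition derivable_in (R : realType) (I : set R) (f : R -> 'rV[R]_3)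
    (t : R) : Prop := cvg (dquot f t s @[s --> within I t^']).

Definition derive_in (R : realType) (I : set R) (f : R -> 'rV[R]_3)
    (t : R) : 'rV[R]_3 := lim (dquot f t s @[s --> within I t^']).

Fixpoint Ck_curve (R : realType) (k : nat) (I : set R)
    (f : R -> 'rV[R]_3) : Prop :=
  match k with
  | 0%N => {within I, continuous f}
  | k'.+1 => (forall t, I t -> derivable_in I f t) /\
             Ck_curve k' I (derive_in I f)
  end.

Definition max_delay (R : realType) (c : R) (Gamma D : set 'rV[R]_3) : R :=
  sup [set enorm (x - y) / c | x in Gamma & y in D].

(* Trajectories are functions on R of which only the values on [0, Tobs] are
   used; see extend for negative times. *)
Definition admissible (R : realType) (c0 : R) (D : set 'rV[R]_3) (Tobs : R)
    (b : R -> 'rV[R]_3) : Prop :=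
  [/\ Ck_curve 2 `[0, Tobs] b,
      (forall t : R, t \in `[0, Tobs] -> D (b t)) &
      (forall t : R, t \in `[0, Tobs] -> enorm (derive_in `[0, Tobs] b t) <= c0)].

Definition extend (R : realType) (b : R -> 'rV[R]_3) (s : R) : 'rV[R]_3 :=
  if s < 0 then b 0 else b s.

(* The r such that r = t - |x - b(r)| / c. Any such r is <= t; it exists and is
   unique when b is admissible with c0 < c and 0 <= t <= Tobs. *)
Definition retarded_time (R : realType) (c : R) (b : R -> 'rV[R]_3)
    (x : 'rV[R]_3) (t : R) : R :=
  get [set r | r = t - enorm (x - extend b r) / c].

Definition doppler (R : realType) (c Tobs : R) (b : R -> 'rV[R]_3)
    (x : 'rV[R]_3) (r : R) : R :=
  1 - dot (derive_in `[0, Tobs] b r) (x - b r) / (c * enorm (x - b r)).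

(* Retarded-potential value, at a point x outside the range of b, of the
   solution of phi_tt / c^2 - Laplacian phi = lambda delta(x - b(t)) with zero
   initial data. *)
Definition field (R : realType) (c lambda Tobs : R) (b : R -> 'rV[R]_3)
    (x : 'rV[R]_3) (t : R) : R :=
  let r := retarded_time c b x t in
  if 0 < r then lambda / (4 * pi * enorm (x - b r) * doppler c Tobs b x r)
  else 0.

(* Rows x_2 - x_1, x_4 - x_3, x_6 - x_5; the points are indexed from 0. *)
Definition diff_matrix (R : realType) (x : 'I_6 -> 'rV[R]_3) : 'M[R]_3 :=
  \matrix_(k < 3) (x (inord (2 * k + 1)) - x (inord (2 * k))).

(* Main.v *)
Require Import Defs.
From mathcomp Require Import all_boot all_order all_algebra.
From mathcomp Require Import all_classical all_reals all_analysis.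
From mathcomp Require Import ring lra.
Import Order.TTheory GRing.Theory Num.Theory.
Import numFieldNormedType.Exports.
Local Open Scope classical_set_scope.
Local Open Scope ring_scope.
Set Implicit Arguments.
Unset Strict Implicit.
Unset Printing Implicit Defensive.

(** Fix an observer x and let A(s) = s + |x - b(s)|/c be the time at which the
    signal emitted at time s reaches it. On [0, Tobs] the derivative of A is the
    Doppler factor h, which is positive because the source is slower than the
    waves ([doppler_gt0]); so A is increasing and continuous, and the retarded
    time r is its inverse on [A(0), Tobs].

    Two facts make the recorded signal decisive. First, it vanishes up to time
    A(0) and is positive afterwards ([field_eq0], [field_arrived]), so the
    signal determines A(0), at which r = 0. Secondly, r' = 1/h while
    |x - b(r)| = c (t - r), so the formula
    phi = lambda / (4 pi |x - b(r)| h) turns into a linear differential equation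
      r'(t) = g(t) (t - r(t)),  g = (4 pi c / lambda) phi >= 0,
    whose coefficient is the measured signal. It involves the trajectory only
    through r, and the square of the difference of two solutions is
    nonincreasing ([linear_ode_unique]); hence equal signals force equal
    retarded times, and with them equal distances |x - b(s)| for every emission
    time s whose signal arrives by Tobs ([enorm_eq_of_field_eq]). Since the
    delay is at most Tobs - T, this covers all s in [0, T].

    Each trajectory point thus has the same distances to the six observers as
    its counterpart. Subtracting the equations |x_i - u|^2 = |x_i - v|^2 in
    pairs leaves the homogeneous linear system of the invertible difference
    matrix for u - v ([eq_of_equidistant]). *)

(** * Euclidean norm on row vectors *)

Lemma dotE (R : realType) (u v : 'rV[R]_3) :
  dot u v = u 0 ord0 * v 0 ord0 + u 0 (inord 1) * v 0 (inord 1)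
            + u 0 (inord 2) * v 0 (inord 2).
Proof.
rewrite /dot !big_ord_recl big_ord0 addr0 addrA.
by congr (_ + u 0 _ * v 0 _ + u 0 _ * v 0 _); apply/val_inj; rewrite /= inordK.
Qed.

Lemma dot_ge0 (R : realType) (u : 'rV[R]_3) : 0 <= dot u u.
Proof. by apply: sumr_ge0 => k _; rewrite -expr2 sqr_ge0. Qed.

Lemma enorm_ge0 (R : realType) (u : 'rV[R]_3) : 0 <= enorm u.
Proof. exact: sqrtr_ge0. Qed.

Lemma sqr_enorm (R : realType) (u : 'rV[R]_3) : enorm u ^+ 2 = dot u u.
Proof. by rewrite sqr_sqrtr ?dot_ge0. Qed.

Lemma dot_gt0 (R : realType) (u : 'rV[R]_3) : u != 0 -> 0 < dot u u.
Proof.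
move=> u0; rewrite lt_neqAle dot_ge0 andbT eq_sym; apply: contra u0.
rewrite psumr_eq0 => [/allP u0|k _]; last by rewrite -expr2 sqr_ge0.
apply/eqP/rowP => k; rewrite mxE.
by have /= := u0 k (mem_index_enum _); rewrite mulf_eq0 orbb => /eqP.
Qed.

Lemma enorm_gt0 (R : realType) (u : 'rV[R]_3) : u != 0 -> 0 < enorm u.
Proof. by move=> u0; rewrite sqrtr_gt0 dot_gt0. Qed.

(** Cauchy-Schwarz, read off Lagrange's identity
    |u|^2 |v|^2 - (u.v)^2 = |u x v|^2. *)
Lemma dot_le_enorm (R : realType) (u v : 'rV[R]_3) :
  dot u v <= enorm u * enorm v.
Proof.
have uv0 : 0 <= enorm u * enorm v by rewrite mulr_ge0 ?enorm_ge0.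
apply: le_trans (ler_norm _) _.
rewrite -(ler_pXn2r (n := 2)) ?nnegrE// real_normK ?num_real//.
rewrite exprMn !sqr_enorm !dotE.
set a := u 0 _; set b := u 0 _; set c := u 0 _.
set d := v 0 _; set e := v 0 _; set f := v 0 _.
rewrite -subr_ge0.
have -> : (a * a + b * b + c * c) * (d * d + e * e + f * f) -
    (a * d + b * e + c * f) ^+ 2 =
    (a * e - b * d) ^+ 2 + (a * f - c * d) ^+ 2 + (b * f - c * e) ^+ 2 by ring.
by rewrite !addr_ge0 ?sqr_ge0.
Qed.

Lemma coord_le_norm (R : realType) (u : 'rV[R]_3) (k : 'I_3) : `|u 0 k| <= `|u|.
Proof.
rewrite [leRHS]/Num.Def.normr/= mx_normrE.
exact: (le_bigmax _ (fun ij : 'I_1 * 'I_3 => `|u ij.1 ij.2|) (0, k)).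
Qed.

(** Only used to transfer boundedness from the sup norm, so the optimal factor
    sqrt 3 is rounded up to 2. *)
Lemma enorm_le_norm (R : realType) (u : 'rV[R]_3) : enorm u <= 2 * `|u|.
Proof.
rewrite -(ler_pXn2r (n := 2)) ?nnegrE ?enorm_ge0 ?mulr_ge0//.
have sq k : u 0 k * u 0 k <= `|u| ^+ 2.
  rewrite -expr2 -[u 0 k ^+ 2]real_normK ?num_real//.
  by rewrite ler_pXn2r ?nnegrE ?coord_le_norm.
rewrite sqr_enorm dotE exprMn.
by have := sq ord0; have := sq (inord 1); have := sq (inord 2); nra.
Qed.

Lemma enorm_continuous (R : realType) : continuous (@enorm R).
Proof.
move=> u; apply: (@continuous_comp _ _ _ (fun v => dot v v)); last first.
  exact: sqrt_continuous.
have sq k : (fun v : 'rV[R]_3 => v 0 k * v 0 k) @ u --> u 0 k * u 0 k.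
  have ck : (fun v : 'rV[R]_3 => v 0 k) @ u --> u 0 k by exact: coord_continuous.
  exact: (cvgM ck ck).
rewrite (_ : (fun v => dot v v) = (fun v => v 0 ord0 * v 0 ord0
    + v 0 (inord 1) * v 0 (inord 1) + v 0 (inord 2) * v 0 (inord 2))).
  exact: cvgD (cvgD (sq _) (sq _)) (sq _).
by apply/funext => v; rewrite dotE.
Qed.

(** * Derivatives relative to an interval *)

Lemma derivable_in_continuous (R : realType) (I : set R) (f : R -> 'rV[R]_3) :
  (forall t, I t -> derivable_in I f t) -> {within I, continuous f}.
Proof.
move=> df; apply/subspace_continuousP => t It.
have [l fl] : exists l : 'rV[R]_3, dquot f t s @[s --> within I t^'] --> l.
  by exists (lim (dquot f t s @[s --> within I t^'])); exact: df.
(* f s = f t + (s - t) *: dquot f t s for s != t. *)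
have lim_f : f t + (s - t) *: dquot f t s @[s --> within I t^'] --> f t + 0 *: l.
  apply: cvgD; first exact: cvg_cst.
  apply: cvgZ fl; rewrite -[0](subrr t); apply: cvgB; last exact: cvg_cst.
  by apply: (@cvg_trans _ t^'); exact: cvg_within.
rewrite scale0r addr0 in lim_f.
move=> U Uft; have := lim_f U Uft.
rewrite /= /nbhs /= /within /= => UI.
rewrite /dnbhs /= /within /= in UI.
near=> s => Is.
have [->|st] := eqVneq s t; first exact: nbhs_singleton.
have : s != t -> I s -> U (f t + (s - t) *: dquot f t s) by near: s; exact: UI.
by move=> /(_ st Is); rewrite /dquot scalerA divff ?subr_eq0// scale1r addrC subrK.
Unshelve. all: by end_near. Qed.

(** At interior points the relative derivative is the ordinary one, so that the
    differentiation rules for real functions apply to each coordinate. *)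
Lemma is_derive_in_coord (R : realType) (I : set R) (f : R -> 'rV[R]_3)
    (t : R) (k : 'I_3) : nbhs t I -> derivable_in I f t ->
  is_derive t (1 : R) (fun s => f s 0 k) (derive_in I f t 0 k).
Proof.
move=> It df.
have lim_k : (dquot f t s) 0 k @[s --> within I t^'] --> derive_in I f t 0 k.
  exact: (cvg_comp _ _ df (@coord_continuous _ _ _ _ _ _)).
have lim_h : h^-1 *: (f (h *: (1 : R) + t) 0 k - f t 0 k) @[h --> 0^']
    --> derive_in I f t 0 k.
  move=> U /lim_k; rewrite /nbhs /= /nbhs /= => UI.
  have sh : (h + t) @[h --> (0 : R)] --> t.
    by rewrite -[X in _ --> X]add0r; apply: cvgD; [exact: cvg_id|exact: cvg_cst].
  have {}UI := sh _ UI; have {}It := sh _ It.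
  rewrite /dnbhs /within /=; near=> h => h0.
  have Ih : I (h + t) by near: h.
  have : h + t != t -> I (h + t) -> U (dquot f t (h + t) 0 k) by near: h.
  rewrite -subr_eq0 addrK => /(_ h0 Ih).
  by rewrite /dquot addrK !mxE /= /GRing.scale /= mulr1.
split; first by apply/cvg_ex; eexists; exact: lim_h.
exact: cvg_lim lim_h.
Unshelve. all: by end_near. Qed.

(** * Arrival and retarded times at one observer *)

Section Observer.
Variables (R : realType) (c c0 Tobs : R) (x : 'rV[R]_3) (b : R -> 'rV[R]_3).
Hypotheses (c_gt0 : 0 < c) (c0_ltc : c0 < c) (Tobs_ge0 : 0 <= Tobs).
Hypothesis b_deriv : forall t : R, `[0, Tobs]%classic t -> derivable_in `[0, Tobs] b t.
Hypothesis b_speed : forall t : R, t \in `[0, Tobs] ->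
  enorm (derive_in `[0, Tobs] b t) <= c0.
Hypothesis b_avoids : forall t : R, t \in `[0, Tobs] -> x - b t != 0.

Definition arrival (s : R) : R := s + enorm (x - b s) / c.

Local Notation h := (doppler c Tobs b x).
Local Notation ret := (retarded_time c b x).

Lemma zero_in_obs : 0 \in `[0, Tobs].
Proof. by rewrite in_itv /= lexx. Qed.

(** Cauchy-Schwarz bounds the radial speed b'.(x - b)/|x - b| by c0 < c. *)
Lemma doppler_gt0 s : s \in `[0, Tobs] -> 0 < h s.
Proof.
move=> s_in; have rho0 := enorm_gt0 (b_avoids s_in).
rewrite /doppler subr_gt0 ltr_pdivrMr ?mulr_gt0// mul1r.
apply: le_lt_trans (dot_le_enorm _ _) _.
by rewrite ltr_pM2r// (le_lt_trans (b_speed s_in)).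
Qed.

Lemma arrival_within_continuous : {within `[0, Tobs], continuous arrival}.
Proof.
have /subspace_continuousP b_cont := derivable_in_continuous b_deriv.
apply/subspace_continuousP => s s_in; apply: cvgD.
  exact: (@cvg_within _ (nbhs s)).
apply: cvgMl.
have : x - b u @[u --> within `[0, Tobs] (nbhs s)] --> x - b s.
  by apply: cvgB; [exact: cvg_cst|exact: b_cont].
by move/(cvg_comp _ _)/(_ (@enorm_continuous _ _)).
Qed.

Lemma is_derive_arrival s : s \in `]0, Tobs[ -> is_derive s (1 : R) arrival (h s).
Proof.
move=> s_in.
have s_in' : s \in `[0, Tobs] by exact: subset_itv_oo_cc.
have near_s : nbhs s (`[0, Tobs]%classic : set R).
  by apply: (filterS (P := `]0, Tobs[%classic));
    [exact: subset_itv_oo_cc|exact: near_in_itvoo].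
have coord k := is_derive_in_coord k near_s (b_deriv s_in').
have xb k : is_derive s (1 : R) (fun u => (x - b u) 0 k)
    (- derive_in `[0, Tobs] b s 0 k).
  rewrite (_ : (fun _ => _) = (cst (x 0 k) - (fun u => b u 0 k))); last first.
    by apply/funext => u; rewrite !mxE.
  by apply: is_derive_eq; rewrite sub0r.
have dd : is_derive s (1 : R) (fun u => dot (x - b u) (x - b u))
    (- 2 * dot (derive_in `[0, Tobs] b s) (x - b s)).
  rewrite (_ : (fun _ => _) =
      \sum_(k < 3) ((fun u => (x - b u) 0 k) * (fun u => (x - b u) 0 k)));
      last first.
    by apply/funext => u; rewrite fct_sumE.
  apply: is_derive_eq.
  rewrite /dot mulr_sumr; apply: eq_bigr => k _; rewrite /GRing.scale /=; ring.
have rho0 := enorm_gt0 (b_avoids s_in').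
have sd : is_derive (dot (x - b s) (x - b s)) (1 : R) Num.sqrt
    (2 * enorm (x - b s))^-1.
  exact/is_derive1_sqrt/dot_gt0/b_avoids.
have rd : is_derive s (1 : R) (fun u => enorm (x - b u))
    (- dot (derive_in `[0, Tobs] b s) (x - b s) / enorm (x - b s)).
  apply: (is_derive_eq (is_derive1_comp sd dd)).
  by rewrite /= /GRing.scale /=; field; rewrite gt_eqF.
rewrite (_ : arrival = id + (c^-1 *: (fun u => enorm (x - b u)))); last first.
  by apply/funext => u; rewrite /arrival mulrC.
apply: is_derive_eq; rewrite /doppler /GRing.scale /=.
by field; rewrite !gt_eqF.
Qed.

Lemma arrival_mono : {in `[0, Tobs] &, {mono arrival : s t / s <= t}}.
Proof.
apply: le_mono_in; apply: gtr0_derive1_lt_cc.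
- by move=> s /is_derive_arrival[].
- move=> s s_in; rewrite derive1E; have /is_derive_arrival[_ ->] := s_in.
  by apply: doppler_gt0; exact: subset_itv_oo_cc.
- exact: arrival_within_continuous.
Qed.

Lemma arrival_ge s : s <= arrival s.
Proof. by rewrite lerDl divr_ge0 ?enorm_ge0 ?ltW. Qed.

(** For r >= 0 the retarded-time equation says that t is the arrival time of the
    signal emitted at r. *)
Lemma arrival_solves r t : 0 <= r ->
  r = t - enorm (x - extend b r) / c <-> arrival r = t.
Proof.
move=> r0; rewrite /extend ltNge r0 /= /arrival.
by split=> [{1}->|<-]; [rewrite subrK|rewrite addrK].
Qed.

(** A root r < 0 would give t = r + |x - b(0)|/c < A(0), and a root r >= 0
    satisfies r <= A(r) <= Tobs, where A is injective. The bound A(s) <= Tobs is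
    needed because nothing is known about b after Tobs. *)
Lemma retarded_time_arrival s : s \in `[0, Tobs] -> arrival s <= Tobs ->
  ret (arrival s) = s.
Proof.
move=> s_in sT; have := s_in; rewrite in_itv => /andP[s0 _].
have z_in := zero_in_obs.
apply: xget_unique => [|r /=]; first exact/arrival_solves.
have [r0|r0 rE] := ltP r 0.
  rewrite /extend r0 => rE.
  have : arrival 0 <= arrival s by rewrite arrival_mono.
  by rewrite /arrival in rE *; lra.
have {rE} := (arrival_solves _ r0).1 rE => rE.
have r_in : r \in `[0, Tobs].
  by rewrite in_itv /= r0 (le_trans (arrival_ge r)) ?rE.
by apply: (mono_inj_in lexx le_anti arrival_mono).
Qed.

Lemma arrival_surj t : arrival 0 <= t <= Tobs ->
  exists2 s, s \in `[0, Tobs] & arrival s = t.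
Proof.
move=> /andP[t0 tT]; apply: (IVT Tobs_ge0 arrival_within_continuous).
by rewrite ge_min le_max t0 (le_trans tT (arrival_ge _)) orbT.
Qed.

Lemma retarded_timeP t : arrival 0 <= t <= Tobs ->
  ret t \in `[0, Tobs] /\ arrival (ret t) = t.
Proof.
move=> t_in; have [s s_in st] := arrival_surj t_in.
by rewrite -st retarded_time_arrival// st; case/andP: t_in.
Qed.

(** Before the first arrival t - |x - b(0)|/c is a root, and a positive root r
    would contradict A(r) = t <= A(0). *)
Lemma retarded_time_le0 t : t <= Tobs -> t <= arrival 0 -> ret t <= 0.
Proof.
move=> tT t0; rewrite leNgt; apply/negP => r0.
have : ret t = t - enorm (x - extend b (ret t)) / c.
  apply: (@getPex _ [set r | r = t - enorm (x - extend b r) / c]).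
  exists (t - enorm (x - b 0) / c) => /=.
  rewrite /arrival add0r in t0.
  rewrite /extend; case: ltP => // e; congr (_ - enorm (x - b _) / c).
  by apply/le_anti; rewrite e /=; lra.
move/(arrival_solves _ (ltW r0)) => rt.
have r_in : ret t \in `[0, Tobs].
  by rewrite in_itv /= ltW//= (le_trans (arrival_ge _)) ?rt.
have z_in := zero_in_obs.
by move: t0; rewrite -{1}rt arrival_mono// leNgt r0.
Qed.


Lemma retarded_time_mono : {in `[arrival 0, Tobs] &, {mono ret : s t / s <= t}}.
Proof.
move=> s t; rewrite !in_itv => /retarded_timeP[s_in sE] /retarded_timeP[t_in tE].
by rewrite -arrival_mono// sE tE.
Qed.

(** A monotone surjection between segments is continuous. *)
Lemma retarded_time_within_continuous : arrival 0 <= Tobs ->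
  {within `[arrival 0, Tobs], continuous ret}.
Proof.
move=> aT; apply: segment_inc_surj_continuous.
  move=> s t s_in t_in; exact: retarded_time_mono.
have [rT_in rT] : ret Tobs \in `[0, Tobs] /\ arrival (ret Tobs) = Tobs.
  by apply: retarded_timeP; rewrite aT lexx.
have z_in := zero_in_obs.
rewrite retarded_time_arrival// => s /=; rewrite in_itv /= => /andP[s0 sT].
have s_in : s \in `[0, Tobs].
  by rewrite in_itv /= s0 (le_trans sT)// -[leRHS]rT arrival_ge.
have as_T : arrival s <= Tobs by rewrite -rT arrival_mono.
exists (arrival s); last exact: retarded_time_arrival.
by rewrite /= in_itv /= as_T arrival_mono// s0.
Qed.

Lemma is_derive_retarded_time t : arrival 0 < t < Tobs ->
  is_derive t (1 : R) ret (h (ret t))^-1.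
Proof.
move=> /andP[t0 tT].
have [r_in rE] : ret t \in `[0, Tobs] /\ arrival (ret t) = t.
  by apply: retarded_timeP; rewrite !ltW.
have z_in := zero_in_obs.
have r_in' : ret t \in `]0, Tobs[.
  have : arrival 0 < arrival (ret t) by rewrite rE.
  rewrite (leW_mono_in arrival_mono)// in_itv /= => -> /=.
  by apply: le_lt_trans tT; rewrite -{2}rE arrival_ge.
have ac s : s \in `]0, Tobs[ -> {for s, continuous arrival}.
  move=> /is_derive_arrival ds; apply: differentiable_continuous.
  by apply/derivable1_diffP; case: ds.
rewrite -{1}rE; apply: is_derive_inverse; last by rewrite gt_eqF// doppler_gt0.
- have near_T : \forall s \near ret t, arrival s < Tobs.
    by apply: (cvgr_lt _ (ac _ r_in')); rewrite rE.
  near=> s; apply: retarded_time_arrival.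
    by apply: subset_itv_oo_cc; near: s; exact: near_in_itvoo.
  by apply: ltW; near: s.
- near=> s; apply: ac; near: s; exact: near_in_itvoo.
- exact: is_derive_arrival.
Unshelve. all: by end_near. Qed.

Variable lambda : R.
Hypothesis lambda_gt0 : 0 < lambda.

Lemma field_eq0 t : t <= Tobs -> t <= arrival 0 -> field c lambda Tobs b x t = 0.
Proof. by move=> tT t0; rewrite /field ltNge retarded_time_le0. Qed.

(** The second conjunct is the differential equation for the retarded time: its
    left-hand side is the derivative of r at t, and the distance |x - b(r)| in
    the denominator of the field has been replaced by c (t - r). *)
Lemma field_arrived t : arrival 0 < t <= Tobs ->
  0 < field c lambda Tobs b x t /\
  (h (ret t))^-1 = 4 * pi * c / lambda * field c lambda Tobs b x t * (t - ret t).
Proof.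
move=> /andP[t0 tT].
have [r_in rE] : ret t \in `[0, Tobs] /\ arrival (ret t) = t.
  by apply: retarded_timeP; rewrite ltW.
have z_in := zero_in_obs.
have r0 : 0 < ret t.
  have : arrival 0 < arrival (ret t) by rewrite rE.
  by rewrite (leW_mono_in arrival_mono).
have rho0 := enorm_gt0 (b_avoids r_in); have h0 := doppler_gt0 r_in.
have pi0 := pi_gt0 R.
rewrite /field r0; split; first by rewrite divr_gt0// !mulr_gt0.
have -> : t - ret t = enorm (x - b (ret t)) / c.
  by move: rE; rewrite /arrival; lra.
(* As an opaque variable, pi is left alone by [field]. *)
move: (pi : R) pi0 => p p0.
by field; rewrite !gt_eqF.
Qed.

End Observer.

(** * The recorded signal determines the distance *)

(** The difference d of two solutions satisfies d' = - g d, hence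
    (d^2)' = - 2 g d^2 <= 0, so that d^2 stays below its initial value 0. *)
Lemma linear_ode_unique (R : realType) (a e : R) (g r r' : R -> R) :
  {within `[a, e], continuous r} -> {within `[a, e], continuous r'} ->
  r a = r' a ->
  (forall t, t \in `]a, e[ -> 0 <= g t) ->
  (forall t, t \in `]a, e[ -> is_derive t (1 : R) r (g t * (t - r t))) ->
  (forall t, t \in `]a, e[ -> is_derive t (1 : R) r' (g t * (t - r' t))) ->
  forall t, t \in `[a, e] -> r t = r' t.
Proof.
move=> rc rc' ra g0 dr dr' t t_in.
have a_in : a \in `[a, e].
  by move: t_in; rewrite !in_itv /= lexx => /andP[]; exact: le_trans.
pose W s := (r s - r' s) ^+ 2.
have dW s : s \in `]a, e[ -> is_derive s (1 : R) W (- 2 * g s * (r s - r' s) ^+ 2).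
  move=> s_in; have ds := dr s s_in; have ds' := dr' s s_in.
  rewrite (_ : W = (r - r') ^+ 2); last by apply/funext.
  apply: is_derive_eq; rewrite -[(r - r') s]/(r s - r' s) /GRing.scale /=; ring.
have Wc : {within `[a, e], continuous W}.
  move/subspace_continuousP in rc; move/subspace_continuousP in rc'.
  apply/subspace_continuousP => s s_in.
  have d : r u - r' u @[u --> within `[a, e] (nbhs s)] --> r s - r' s.
    by apply: cvgB; [exact: rc|exact: rc'].
  exact: (cvg_comp _ _ d (@exprn_continuous _ 2 _)).
have : W t <= W a.
  apply: (ler0_derive1_le_cc _ _ Wc) => //.
  - by move=> s /dW[].
  - move=> s s_in; rewrite derive1E; have [_ ->] := dW s s_in.
    by rewrite mulNr mulNr oppr_le0 mulr_ge0 ?sqr_ge0// mulr_ge0 ?g0.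
  - by move: t_in; rewrite in_itv => /andP[].
rewrite /W ra subrr expr0n /= => Wt.
have : (r t - r' t) ^+ 2 == 0 by rewrite eq_le Wt sqr_ge0.
by rewrite sqrf_eq0 subr_eq0 => /eqP.
Qed.

(** The first arrival times agree, since otherwise, at the later of the two, one
    field would vanish and the other be positive. From then on the retarded
    times solve the same differential equation with the same initial value 0, so
    they coincide; inverting them gives equal arrival times, that is, equal
    delays. *)
Lemma enorm_eq_of_field_eq (R : realType) (c c0 lambda Tobs : R) (x : 'rV[R]_3)
    (b b' : R -> 'rV[R]_3) :
  0 < c -> c0 < c -> 0 < lambda ->
  (forall t, `[0, Tobs]%classic t -> derivable_in `[0, Tobs] b t) ->
  (forall t, `[0, Tobs]%classic t -> derivable_in `[0, Tobs] b' t) ->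
  (forall t : R, t \in `[0, Tobs] -> enorm (derive_in `[0, Tobs] b t) <= c0) ->
  (forall t : R, t \in `[0, Tobs] -> enorm (derive_in `[0, Tobs] b' t) <= c0) ->
  (forall t : R, t \in `[0, Tobs] -> x - b t != 0) ->
  (forall t : R, t \in `[0, Tobs] -> x - b' t != 0) ->
  arrival c x b 0 < Tobs -> arrival c x b' 0 < Tobs ->
  (forall t : R, t \in `[0, Tobs] ->
    field c lambda Tobs b x t = field c lambda Tobs b' x t) ->
  forall s, s \in `[0, Tobs] -> arrival c x b s <= Tobs ->
    enorm (x - b s) = enorm (x - b' s).
Proof.
move=> c_gt0 c0_ltc lambda_gt0 db db' vb vb' ab ab' bT bT' ff s s_in sT.
have a0 : 0 <= arrival c x b 0 by exact: arrival_ge.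
have a0' : 0 <= arrival c x b' 0 by exact: arrival_ge.
have T0 : 0 <= Tobs by rewrite (le_trans a0)// ltW.
have fa := field_arrived c_gt0 c0_ltc T0 db vb ab lambda_gt0.
have fa' := field_arrived c_gt0 c0_ltc T0 db' vb' ab' lambda_gt0.
have aa : arrival c x b 0 = arrival c x b' 0.
  apply/eqP; rewrite eq_le !leNgt; apply/andP; split; apply/negP => lt_a.
  - have [] := fa' (arrival c x b 0); first by rewrite lt_a ltW.
    rewrite -ff ?in_itv /= ?a0 ?(ltW bT)//.
    by rewrite (field_eq0 c_gt0 c0_ltc T0 db vb ab) ?ltxx// ltW.
  - have [] := fa (arrival c x b' 0); first by rewrite lt_a ltW.
    rewrite ff ?in_itv /= ?a0' ?(ltW bT')//.
    by rewrite (field_eq0 c_gt0 c0_ltc T0 db' vb' ab') ?ltxx// ltW.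
have rE := retarded_time_arrival c_gt0 c0_ltc T0 db vb ab.
have rE' := retarded_time_arrival c_gt0 c0_ltc T0 db' vb' ab'.
have z_in := zero_in_obs T0.
pose g t := 4 * pi * c / lambda * field c lambda Tobs b x t.
have rr : forall t, t \in `[arrival c x b 0, Tobs] ->
    retarded_time c b x t = retarded_time c b' x t.
  have pi0 := pi_gt0 R.
  apply: (@linear_ode_unique _ _ _ g).
  - exact: (retarded_time_within_continuous c_gt0 c0_ltc T0 db vb ab (ltW bT)).
  - rewrite aa.
    exact: (retarded_time_within_continuous c_gt0 c0_ltc T0 db' vb' ab' (ltW bT')).
  - by rewrite rE ?ltW// aa rE' ?ltW.
  - move=> t; rewrite in_itv /= => /andP[t0 tT].
    have [|ft _] := fa t; first by rewrite t0 ltW.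
    by rewrite /g mulr_ge0 ?(ltW ft)// divr_ge0 ?mulr_ge0 ?ltW.
  - move=> t; rewrite in_itv /= => t_in.
    have := is_derive_retarded_time c_gt0 c0_ltc T0 db vb ab t_in.
    have [|_ ->] := fa t; first by case/andP: t_in => -> /ltW ->.
    by [].
  - move=> t; rewrite in_itv /= => t_in.
    have t_in' : arrival c x b' 0 < t < Tobs by rewrite -aa.
    have := is_derive_retarded_time c_gt0 c0_ltc T0 db' vb' ab' t_in'.
    have [|_ ->] := fa' t; first by case/andP: t_in' => -> /ltW ->.
    rewrite /g ff//; case/andP: t_in => /ltW t0 /ltW tT.
    by rewrite in_itv /= tT (le_trans a0).
set t := arrival c x b s.
have t_in : arrival c x b 0 <= t <= Tobs.
  by rewrite sT (arrival_mono c_gt0 c0_ltc db vb ab)// andbT; case/andP: s_in.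
have t_in' : arrival c x b' 0 <= t <= Tobs by rewrite -aa.
have [_] := retarded_timeP c_gt0 c0_ltc T0 db' vb' ab' t_in'.
rewrite -rr ?in_itv// /t rE// /arrival => /addrI/(congr1 ( *%R^~ c)).
by rewrite !divfK ?gt_eqF.
Qed.

(** * Position from distances *)

(** |p - u|^2 = |p - v|^2 and |q - u|^2 = |q - v|^2 share the quadratic part
    |u|^2 - |v|^2, which cancels in their difference. *)
Lemma dot_eq_of_equidistant (R : realType) (p q u v : 'rV[R]_3) :
  enorm (p - u) = enorm (p - v) -> enorm (q - u) = enorm (q - v) ->
  dot (q - p) (u - v) = 0.
Proof.
move=> /(congr1 (fun r => r ^+ 2)) + /(congr1 (fun r => r ^+ 2)).
rewrite !sqr_enorm !dotE !mxE; lra.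
Qed.

Lemma eq_of_equidistant (R : realType) (x : 'I_6 -> 'rV[R]_3) (u v : 'rV[R]_3) :
  diff_matrix x \in unitmx ->
  (forall i, enorm (x i - u) = enorm (x i - v)) -> u = v.
Proof.
move=> Xu eqd; apply/subr0_eq/trmx_inj; rewrite trmx0.
apply: (can_inj (mulKmx Xu)); rewrite mulmx0.
apply/matrixP => k j; rewrite !mxE.
rewrite -[RHS](dot_eq_of_equidistant (eqd (inord (2 * k))) (eqd (inord (2 * k + 1)))).
by apply: eq_bigr => l _; rewrite !mxE [j]ord1.
Qed.

(** * Bounds on the delay *)

Lemma boundary_open_disjoint (T : topologicalType) (A : set T) (p : T) :
  open A -> boundary A p -> ~ A p.
Proof. by move=> /interior_id Ao [_]; rewrite Ao. Qed.

Lemma bounded_closure (R : realType) (A : set 'rV[R]_3) :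
  bounded_set A -> exists M : R, forall p, closure A p -> `|p| <= M.
Proof.
move=> [M [_ AM]]; exists (M + 1) => p.
have AM1 q : A q -> `|q| <= M + 1 by move/(AM (M + 1)); apply; rewrite ltrDl.
have ball_closed : closed [set q : 'rV[R]_3 | `|q| <= M + 1].
  apply: (@preimage_closed _ _ (fun q : 'rV[R]_3 => `|q|) [set r : R | r <= M + 1]).
    by move=> q _; exact: norm_continuous.
  exact: closed_le.
by move/(closureS AM1); rewrite -((closure_id _).1 ball_closed).
Qed.

(** The bounds M and N make the set of delays bounded, without which its supremum
    would be a default value. *)
Lemma le_max_delay (R : realType) (c : R) (Gamma D : set 'rV[R]_3) (M N : R) p q :
  0 < c -> (forall p, Gamma p -> `|p| <= M) -> (forall q, D q -> `|q| <= N) ->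
  Gamma p -> D q -> enorm (p - q) / c <= max_delay c Gamma D.
Proof.
move=> c0 GM DN Gp Dq; apply: sup_upper_bound; last by exists p => //; exists q.
split; first by exists (enorm (p - q) / c), p => //; exists q.
exists (2 * (M + N) / c) => _ [p' Gp' [q' Dq' <-]].
rewrite ler_pM2r ?invr_gt0//; apply: le_trans (enorm_le_norm _) _.
by rewrite ler_pM2l// (le_trans (ler_normB _ _))// lerD ?GM ?DN.
Qed.

(** * The theorem *)

Unset Implicit Arguments.

Theorem theorem3p1 (R : realType) (c lambda c0 : R)
    (hc : 0 < c) (hlambda : 0 < lambda) (hc0 : 0 <= c0) (hc0c : c0 < c)
    (D Omega : set 'rV[R]_3)
    (hD : bounded_domain D) (hOmega : smooth_bounded_domain Omega)
    (hDOmega : closure D `<=` Omega)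
    (T : R) (hT : max_delay c (boundary Omega) D < T)
    (x : 'I_6 -> 'rV[R]_3) (hx : forall i, boundary Omega (x i))
    (hX : diff_matrix x \in unitmx) :
  let Tobs := T + max_delay c (boundary Omega) D in
  forall b b' : R -> 'rV[R]_3,
    admissible c0 D Tobs b -> admissible c0 D Tobs b' ->
    (forall (i : 'I_6) (t : R), t \in `[0, Tobs] ->
       field c lambda Tobs b (x i) t = field c lambda Tobs b' (x i) t) ->
    forall t : R, t \in `[0, T] -> b t = b' t.
Proof.
move=> Tobs b b' [[db _] bD vb] [[db' _] bD' vb'] ff t t_in.
have [[_ Omega_open _ /bounded_closure[M OM]] _] := hOmega.
have [_ _ _ /bounded_closure[N DN]] := hD.
have delay p q : boundary Omega p -> D q ->
    enorm (p - q) / c <= max_delay c (boundary Omega) D.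
  apply: (@le_max_delay _ _ _ _ M N) => // [p' [Op' _]|q' Dq']; first exact: OM.
  exact/DN/subset_closure.
have avoids p q : boundary Omega p -> D q -> p - q != 0.
  move=> Op Dq; apply/eqP => /subr0_eq pq.
  apply: (boundary_open_disjoint Omega_open Op).
  by rewrite pq; exact/hDOmega/subset_closure.
have [q Dq] : D !=set0 by case: hD.
have delay0 : 0 <= max_delay c (boundary Omega) D.
  by apply: le_trans (delay _ _ (hx ord0) Dq); rewrite divr_ge0 ?enorm_ge0 ?ltW.
have Tobs0 : 0 \in `[0, Tobs] by rewrite in_itv /= lexx /Tobs; lra.
have early i b1 : D (b1 0) -> arrival c (x i) b1 0 < Tobs.
  move=> Db; have := delay _ _ (hx i) Db; rewrite /arrival /Tobs; lra.
have t_obs : t \in `[0, Tobs].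
  by move: t_in; rewrite !in_itv /= => /andP[-> tT]; rewrite /Tobs; lra.
apply: (eq_of_equidistant hX) => i.
apply: (enorm_eq_of_field_eq hc hc0c hlambda db db' vb vb') => //.
- by move=> s /bD; exact: avoids.
- by move=> s /bD'; exact: avoids.
- exact/early/bD.
- exact/early/bD'.
- exact: ff.
- have := delay _ _ (hx i) (bD _ t_obs).
  by move: t_in; rewrite in_itv /= /arrival /Tobs => /andP[_]; lra.
Qed.
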